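(* Let $K$ be a field of characteristic $2$, let $n,m\ge 2$ be integers, and let $$G=\langle a,b \mid a^{2^n}=b^{2^m}=c^2=1,\ (a,b)=c,\ (a,c)=1,\ (b,c)=1\rangle,$$ where $c$ denotes the commutator $(a,b)$. Then the group algebra $KG$ possesses a filtered multiplicative $K$-basis.
   Context: Let $A$ be a finite-dimensional (associative, unital) algebra over a field $K$. A $K$-basis $B$ of $A$ is called a filtered multiplicative $K$-basis of $A$ if: (1) whenever $u,v\in B$, either $uv=0$ or $uv\in B$; and (2) $B\cap \mathrm{rad}(A)$ is a $K$-basis of $\mathrm{rad}(A)$, where $\mathrm{rad}(A)$ is the Jacobson radical of $A$. Notation: $(x,y)=x^{-1}y^{-1}xy$ is the commutator. *)

(* Defs.v *)
From HB Require Import structures.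
From mathcomp Require Import all_boot all_order all_algebra.
From mathcomp Require Import all_fingroup all_solvable all_field.
From mathcomp Require Import boolp.

Set Implicit Arguments.
Unset Strict Implicit.
Unset Printing Implicit Defensive.

Import GRing.Theory.
Local Open Scope ring_scope.

Section JacobsonRadical.
Variables (K : fieldType) (A : falgType K).
Implicit Types (I L M J : {vspace A}) (x : A).

(* As A is unital, every left ideal is a K-subspace, so nothing is lost by
   ranging over {vspace A}. *)
Definition left_ideal I := ({:A} * I <= I)%VS.

Definition maximal_left_ideal M :=
  [/\ left_ideal M, M != fullv &
      forall L, left_ideal L -> (M <= L)%VS -> L = M \/ L = fullv].

Lemma jacobson_radical_subproof :
  exists J, forall x, x \in J <-> forall M, maximal_left_ideal M -> x \in M.
Proof.
pose small J := forall M, maximal_left_ideal M -> (J <= M)%VS.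
pose P d := `[< exists2 J, small J & \dim J = d >].
have exP : exists d, P d.
  by exists 0%N; apply/asboolP; exists 0%VS; [move=> M _; exact: sub0v | exact: dimv0].
have boundP d : P d -> (d <= \dim {:A})%N.
  by move=> /asboolP[J _ <-]; apply/dimvS/subvf.
case: (ex_maxnP exP boundP) => d /asboolP[J smallJ dimJ] maxd.
exists J => x; split=> [Jx M maxM | radx]; first exact: subvP (smallJ M maxM) x Jx.
have smallJx : small (J + <[x]>)%VS.
  by move=> M maxM; rewrite subv_add smallJ // -memvE radx.
suff /eqP-> : J == (J + <[x]>)%VS by rewrite memvE addvSr.
rewrite eqEdim addvSl dimJ maxd //.
by apply/asboolP; exists (J + <[x]>)%VS.
Qed.

Definition jacobson_radical : {vspace A} := sval (cid jacobson_radical_subproof).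

Lemma mem_jacobson_radical x :
  x \in jacobson_radical <-> forall M, maximal_left_ideal M -> x \in M.
Proof. exact: (svalP (cid jacobson_radical_subproof)). Qed.

(* A basis is a sequence B; basis_of makes it free, hence duplicate-free. *)
Definition filtered_multiplicative_basis (B : seq A) :=
  [/\ basis_of fullv B,
      {in B &, forall u v, u * v = 0 \/ u * v \in B} &
      basis_of jacobson_radical [seq b <- B | b \in jacobson_radical]].

End JacobsonRadical.

(* The group algebra KG of a finite group G (given as a type): functions G -> K
   under convolution.  The alias keeps this product apart from the pointwise
   one on {ffun G -> K}. *)
Definition group_algebra (K : fieldType) (gT : finGroupType) : Type :=
  {ffun gT -> K^o}.

Section GroupAlgebra.
Variables (K : fieldType) (gT : finGroupType).
Local Notation KG := (group_algebra K gT).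

HB.instance Definition _ := Vector.copy KG {ffun gT -> K^o}.

Implicit Types (u v w : KG) (g h : gT).

Definition galg_coef u g : K := (u : {ffun gT -> K^o}) g.

Definition galg_elt g : KG := [ffun h => (h == g)%:R].

Definition galg_mul u v : KG :=
  [ffun g => \sum_h galg_coef u h * galg_coef v (h^-1 * g)%g].

Lemma galg_eqP u v : galg_coef u =1 galg_coef v <-> u = v.
Proof. by split=> [e | -> //]; apply/ffunP. Qed.

Lemma galg_coefD u v g : galg_coef (u + v) g = galg_coef u g + galg_coef v g.
Proof. exact: ffunE. Qed.

Lemma galg_coefZ (k : K) u g : galg_coef (k *: u) g = k * galg_coef u g.
Proof. exact: ffunE. Qed.

Lemma galg_coef_elt g h : galg_coef (galg_elt g) h = (h == g)%:R.
Proof. exact: ffunE. Qed.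

Lemma galg_coef_mul u v g :
  galg_coef (galg_mul u v) g =
  \sum_h galg_coef u h * galg_coef v (h^-1 * g)%g.
Proof. exact: ffunE. Qed.

Lemma galg_mulA : associative galg_mul.
Proof.
move=> u v w; apply/galg_eqP => g; rewrite !galg_coef_mul.
under eq_bigr do rewrite galg_coef_mul mulr_sumr.
under [RHS]eq_bigr do rewrite galg_coef_mul mulr_suml.
rewrite [RHS]exchange_big /=; apply: eq_bigr => h _.
rewrite [RHS](reindex_inj (mulgI h)) /=; apply: eq_bigr => k _.
by rewrite mulrA mulKg invMg mulgA.
Qed.

Lemma galg_mul1l : left_id (galg_elt 1%g) galg_mul.
Proof.
move=> u; apply/galg_eqP => g; rewrite galg_coef_mul (bigD1 1%g) //= big1.
  by rewrite galg_coef_elt eqxx mul1r invg1 mul1g addr0.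
by move=> h /negPf h1; rewrite galg_coef_elt h1 mul0r.
Qed.

Lemma galg_mul1r : right_id (galg_elt 1%g) galg_mul.
Proof.
move=> u; apply/galg_eqP => g; rewrite galg_coef_mul (bigD1 g) //= big1.
  by rewrite galg_coef_elt mulVg eqxx mulr1 addr0.
move=> h hg; rewrite galg_coef_elt -eq_mulVg1.
by rewrite (negPf hg) mulr0.
Qed.

Lemma galg_mulDl : left_distributive galg_mul +%R.
Proof.
move=> u v w; apply/galg_eqP => g; rewrite galg_coefD !galg_coef_mul -big_split.
by apply: eq_bigr => h _; rewrite galg_coefD mulrDl.
Qed.

Lemma galg_mulDr : right_distributive galg_mul +%R.
Proof.
move=> u v w; apply/galg_eqP => g; rewrite galg_coefD !galg_coef_mul -big_split.
by apply: eq_bigr => h _; rewrite galg_coefD mulrDr.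
Qed.

Lemma galg_oner_neq0 : galg_elt 1%g != 0.
Proof.
apply/eqP => /galg_eqP/(_ 1%g) /eqP.
by rewrite galg_coef_elt eqxx /galg_coef ffunE oner_eq0.
Qed.

HB.instance Definition _ := GRing.Zmodule_isNzRing.Build KG
  galg_mulA galg_mul1l galg_mul1r galg_mulDl galg_mulDr galg_oner_neq0.

Lemma galg_scaleAl (k : K) u v : k *: (u * v) = (k *: u) * v.
Proof.
apply/galg_eqP => g; rewrite galg_coefZ !galg_coef_mul mulr_sumr.
by apply: eq_bigr => h _; rewrite galg_coefZ mulrA.
Qed.

Lemma galg_scaleAr (k : K) u v : k *: (u * v) = u * (k *: v).
Proof.
apply/galg_eqP => g; rewrite galg_coefZ !galg_coef_mul mulr_sumr.
by apply: eq_bigr => h _; rewrite galg_coefZ mulrCA.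
Qed.

HB.instance Definition _ := GRing.Lmodule_isLalgebra.Build K KG galg_scaleAl.
HB.instance Definition _ := GRing.Lalgebra_isAlgebra.Build K KG galg_scaleAr.
HB.instance Definition _ := Algebra_isFalgebra.Build K KG.

Lemma galg_elt1 : galg_elt 1%g = 1.
Proof. by []. Qed.

Lemma galg_eltM g h : galg_elt (g * h)%g = galg_elt g * galg_elt h.
Proof.
apply/galg_eqP => k; rewrite galg_coef_mul (bigD1 g) //= big1.
  by rewrite !galg_coef_elt eqxx mul1r addr0 -[in LHS](mulKVg g k) (inj_eq (mulgI g)).
by move=> l /negPf lg; rewrite galg_coef_elt lg mul0r.
Qed.

Lemma galg_sum_elt u : u = \sum_g galg_coef u g *: galg_elt g.
Proof.
apply/ffunP => h; rewrite sum_ffunE (bigD1 h) //= big1.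
  by rewrite !ffunE eqxx [RHS]addr0 /GRing.scale /= mulr1.
by move=> g /negPf; rewrite !ffunE eq_sym => ->; rewrite scaler0.
Qed.

End GroupAlgebra.

(* Main.v *)
Require Import Defs.
From mathcomp Require Import all_boot all_order all_algebra.
From mathcomp Require Import all_fingroup all_solvable all_field.
From mathcomp Require Import zify.

(* Put x = a + 1 and y = b + 1 in KG.  As c is a central involution, x^2 and y^2
   are central; moreover yx - xy is a multiple of 1 + c, which is central with
   square 0, and (xy)^2 = (yx)^2 follows.  Together with x^(2^n) = y^(2^m) = 0
   these relations reduce every word in x and y, without changing its length,
   to 0 or to some x^(2i) y^(2j) w with i < 2^(n-1), j < 2^(m-1) and w one of
   the 8 words 1, x, y, xy, yx, xyx, yxy, xyxy.  These 2^(n+m+1) elements span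
   KG, whose dimension is at least that, so they form a basis, and it is
   multiplicative.  As lengths add up, those of positive length span a
   nilpotent ideal of codimension 1, which is the radical. *)

(** * Maximal left ideals and the radical of a finite-dimensional algebra *)

Section JacobsonRadical.

Import GRing.Theory.
Local Open Scope ring_scope.

Context {K : fieldType} {A : falgType K}.

(** A proper left ideal of largest dimension is maximal; the zero ideal is a first candidate. *)
Lemma exists_maximal_left_ideal : exists M : {vspace A}, maximal_left_ideal M.
Proof.
pose P d := boolp.asbool (exists M : {vspace A},
  [/\ left_ideal M, M != fullv & \dim M = d]).
have exP : exists d, P d.
  exists 0%N; apply/boolp.asboolP; exists 0%VS; split; last exact: dimv0.
    by rewrite /left_ideal prodv0.
  apply/eqP => e; have := memvf (1 : A).
  by rewrite -e memv0 oner_eq0.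
have boundP d : P d -> (d <= \dim {:A})%N.
  by move=> /boolp.asboolP[M [_ _ <-]]; apply/dimvS/subvf.
case: (ex_maxnP exP boundP) => d /boolp.asboolP[M [Ml Mf <-]] maxM.
exists M; split=> // L Ll ML.
have [->|Lf] := eqVneq L fullv; [by right | left].
apply/esym/eqP; rewrite eqEdim ML maxM //.
by apply/boolp.asboolP; exists L.
Qed.

Lemma one_notin_maximal_left_ideal (M : {vspace A}) :
  maximal_left_ideal M -> 1 \notin M.
Proof.
case=> Ml /negP Mf _; apply/negP => M1; apply: Mf.
rewrite eqEsubv subvf /=; apply/subvP => u _; rewrite -[u]mulr1.
by apply: (subvP Ml); rewrite memv_mul ?memvf.
Qed.

Lemma one_notin_jacobson_radical : 1 \notin jacobson_radical A.
Proof.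
case: exists_maximal_left_ideal => M Mm.
apply/negP => /mem_jacobson_radical/(_ M Mm).
by apply/negP/one_notin_maximal_left_ideal.
Qed.

(** If a maximal [M] satisfies [M + I = A], then [1 = k + v] with [k] in [M] and [v] nilpotent in
    [I]. The geometric series in [v] inverts [k = 1 - v], which forces [1] into [M]. *)
Lemma nil_left_ideal_sub_jacobson_radical (I : {vspace A}) :
    left_ideal I -> {in I, forall u, exists d, u ^+ d = 0} ->
  (I <= jacobson_radical A)%VS.
Proof.
move=> Il Inil; apply/subvP => i Ii; apply/mem_jacobson_radical => M Mm.
have [Ml Mf /(_ (M + I)%VS)] := Mm; case.
- by rewrite /left_ideal prodvDr addvS.
- exact: addvSl.
- by move=> <-; apply: (subvP (addvSr M I)).
move=> MI; case/negP: (one_notin_maximal_left_ideal _ Mm).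
have: 1 \in (M + I)%VS by rewrite MI memvf.
case/memv_addP => k Mk [v Iv e]; have [d vd] := Inil v Iv.
have -> : 1 = (\sum_(j < d) v ^+ j) * k.
  have -> : k = 1 - v by rewrite e addrK.
  have comm_v : GRing.comm (1 - v) (\sum_(j < d) v ^+ j).
    apply: commr_sum => j _; apply: commrX; apply: commr_sym.
    exact: commrB (commr1 v) (commr_refl v).
  by rewrite -comm_v -[1 - v]opprB mulNr -subrX1 vd opprB subr0.
by apply: (subvP Ml); rewrite memv_mul ?memvf.
Qed.

(** Passes to generators one factor at a time: the condition on one factor defines the preimage of
    [W] under a left or right multiplication, which is a subspace. *)
Lemma span_prod_sub (X Y : seq A) (W : {vspace A}) :
    {in X & Y, forall u v, u * v \in W} -> (<<X>> * <<Y>> <= W)%VS.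
Proof.
move=> XYW; apply/prodvP => u v Xu Yv.
have XYvW : {in X, forall u, u * v \in W}.
  move=> {Xu}u Xu; suff: amull u v \in W by rewrite lfunE.
  rewrite memv_preim; apply: subvP v Yv; apply/span_subvP => v Yv.
  by rewrite -memv_preim lfunE XYW.
suff: amulr v u \in W by rewrite lfunE.
rewrite memv_preim; apply: subvP u Xu; apply/span_subvP => u Xu.
by rewrite -memv_preim lfunE; exact: XYvW.
Qed.

End JacobsonRadical.

(** * A multiplicative basis of monomials in two generators *)

Section MonomialBasis.

Import GRing.Theory.
Local Open Scope ring_scope.

Context {K : fieldType} {A : falgType K} (x y : A) (N M : nat).

(** Words are kept as boolean sequences because the argument counts letters, and an element of [A]
    carries no length of its own. *)
Let letter (e : bool) := if e then x else y.

Let word (s : seq bool) := \prod_(e <- s) letter e.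

(** Alternating words of length at most 4; [yxyx] is left out, being equal to [xyxy]. *)
Let alternating : seq (seq bool) :=
  [:: [::]; [:: true]; [:: false]; [:: true; false]; [:: false; true];
      [:: true; false; true]; [:: false; true; false];
      [:: true; false; true; false]].

Let square_words : seq (seq bool) :=
  [seq nseq i.*2 true ++ nseq j.*2 false | i <- iota 0 N, j <- iota 0 M].

Let normal_words : seq (seq bool) :=
  [seq s ++ w | s <- square_words, w <- alternating].

Hypothesis x2y : x * x * y = y * (x * x).
Hypothesis y2x : y * y * x = x * (y * y).
Hypothesis xyxy : x * y * x * y = y * x * y * x.
Hypothesis xnil : (x * x) ^+ N = 0.
Hypothesis ynil : (y * y) ^+ M = 0.
Hypothesis gen : forall V : {vspace A}, 1 \in V ->
  {in V, forall u, u * x \in V /\ u * y \in V} -> V = fullv.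
Hypothesis dimA : (N * M * 8 <= \dim {:A})%N.

(** A new letter either extends the alternation or meets its own copy, possibly after [xyxy] is
    rewritten as [yxyx]; the square so formed is moved to the front. In both cases the total length
    grows by exactly one. *)
Let alternating_step w e : w \in alternating ->
  (exists2 w', w' \in alternating &
     size w' = (size w).+1 /\ word w * letter e = word w') \/
  (exists2 w', w' \in alternating &
     size w = (size w').+1 /\ word w * letter e = letter e * letter e * word w').
Proof.
have x2y1 : y * x * x = x * x * y by rewrite -mulrA -x2y.
have x2yu u : u * y * x * x = u * x * x * y by rewrite -!mulrA -x2y !mulrA.
have y2x1 : x * y * y = y * y * x by rewrite -mulrA -y2x.
have y2xu u : u * x * y * y = u * y * y * x by rewrite -!mulrA -y2x !mulrA.
rewrite /alternating !inE.
move=> /or4P[/eqP->|/eqP->|/eqP->|/or4P[/eqP->|/eqP->|/eqP->|/orP[] /eqP->]];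
  case: e.
- left; exists [:: true] => //.
  by rewrite /word !big_cons !big_nil mul1r mulr1.
- left; exists [:: false] => //.
  by rewrite /word !big_cons !big_nil mul1r mulr1.
- right; exists [::] => //.
  by rewrite /word !big_cons !big_nil !mulr1.
- left; exists [:: true; false] => //.
  by rewrite /word !big_cons !big_nil !mulr1.
- left; exists [:: false; true] => //.
  by rewrite /word !big_cons !big_nil !mulr1.
- right; exists [::] => //.
  by rewrite /word !big_cons !big_nil !mulr1.
- left; exists [:: true; false; true] => //.
  by rewrite /word !big_cons !big_nil !mulr1 !mulrA.
- right; exists [:: true] => //.
  by rewrite /word !big_cons !big_nil !mulr1.
- right; exists [:: false] => //.
  by rewrite /word !big_cons !big_nil !mulr1.
- left; exists [:: false; true; false] => //.
  by rewrite /word !big_cons !big_nil !mulr1 !mulrA.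
- right; exists [:: true; false] => //.
  by rewrite /word !big_cons !big_nil !mulr1 !mulrA /= x2yu.
- left; exists [:: true; false; true; false] => //.
  by rewrite /word !big_cons !big_nil !mulr1 !mulrA.
- left; exists [:: true; false; true; false] => //.
  by rewrite /word !big_cons !big_nil !mulr1 !mulrA /= xyxy.
- right; exists [:: false; true] => //.
  by rewrite /word !big_cons !big_nil !mulr1 !mulrA /= y2xu.
- right; exists [:: false; true; false] => //.
  by rewrite /word !big_cons !big_nil !mulr1 !mulrA /= xyxy x2yu x2y1.
- right; exists [:: true; false; true] => //.
  by rewrite /word !big_cons !big_nil !mulr1 !mulrA /= y2xu y2x1.
Qed.

Let wordE i j w : word ((nseq i.*2 true ++ nseq j.*2 false) ++ w) =
  (x * x) ^+ i * (y * y) ^+ j * word w.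
Proof.
by rewrite /word !big_cat /= !big_nseq !iter_mulr_1 -!muln2 ![(_ * 2)%N]mulnC
  !exprM.
Qed.

Let normal_wordsP t : reflect
  (exists i j w, [/\ (i < N)%N, (j < M)%N, w \in alternating &
    t = (nseq i.*2 true ++ nseq j.*2 false) ++ w]) (t \in normal_words).
Proof.
apply: (iffP idP) => [/allpairsP[[_ w] [/allpairsP[[i j] [/= iN jM ->]] /= aw ->]]|].
  by exists i, j, w; move: iN jM; rewrite !mem_iota /= !add0n.
case=> i [j [w [iN jM aw ->]]]; apply: allpairs_f => //.
by apply: allpairs_f; rewrite mem_iota.
Qed.

Let comm_squares : (x * x) * (y * y) = (y * y) * (x * x).
Proof. by rewrite mulrA x2y -mulrA x2y mulrA. Qed.

(** A square sent to the front raises one of the exponents [i], [j]; the product vanishes when that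
    exponent reaches [N] or [M]. *)
Let normal_step t e : t \in normal_words -> word t * letter e = 0 \/
  exists2 t', t' \in normal_words &
    size t' = (size t).+1 /\ word t * letter e = word t'.
Proof.
case/normal_wordsP => i [j [w [iN jM aw ->]]]; rewrite wordE -mulrA.
case: (alternating_step w e aw) => [[w' aw' [sw' ->]]|[w' aw' [sw' ->]]].
  right; exists ((nseq i.*2 true ++ nseq j.*2 false) ++ w').
    by apply/normal_wordsP; exists i, j, w'.
  by rewrite wordE !size_cat sw' addnS.
rewrite !mulrA; case: e => /=.
  have -> : (x * x) ^+ i * (y * y) ^+ j * x * x * word w' =
            (x * x) ^+ i.+1 * (y * y) ^+ j * word w'.
    rewrite exprSr -!mulrA; congr (_ * _); rewrite !mulrA; congr (_ * _).
    by rewrite -mulrA; apply/commr_sym/commrX/comm_squares.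
  have [iN'|] := ltnP i.+1 N; last first.
    move=> Ni; have -> : i.+1 = N by apply/eqP; rewrite eqn_leq iN.
    by left; rewrite xnil !mul0r.
  right; exists ((nseq i.+1.*2 true ++ nseq j.*2 false) ++ w').
    by apply/normal_wordsP; exists i.+1, j, w'.
  by rewrite wordE !size_cat !size_nseq sw'; split=> //; rewrite !addnS.
have -> : (x * x) ^+ i * (y * y) ^+ j * y * y * word w' =
          (x * x) ^+ i * (y * y) ^+ j.+1 * word w'.
  by rewrite exprSr !mulrA.
have [jM'|] := ltnP j.+1 M; last first.
  move=> Mj; have -> : j.+1 = M by apply/eqP; rewrite eqn_leq jM.
  by left; rewrite ynil mulr0 mul0r.
right; exists ((nseq i.*2 true ++ nseq j.+1.*2 false) ++ w').
  by apply/normal_wordsP; exists i, j.+1, w'.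
by rewrite wordE !size_cat !size_nseq sw'; split=> //; rewrite !addnS.
Qed.

(** For [N = 0] the nilpotency hypothesis would read [1 = 0]. *)
Let N_gt0 : (0 < N)%N.
Proof. by case: N xnil => // /eqP; rewrite expr0 oner_eq0. Qed.

Let M_gt0 : (0 < M)%N.
Proof. by case: M ynil => // /eqP; rewrite expr0 oner_eq0. Qed.

Let nil_normal : [::] \in normal_words.
Proof. by apply/normal_wordsP; exists 0%N, 0%N, [::]. Qed.

Let normal_form s : word s = 0 \/
  exists2 t, t \in normal_words & size t = size s /\ word s = word t.
Proof.
elim/last_ind: s => [|s e IH]; first by right; exists [::].
rewrite /word big_rcons /= -/(word s) size_rcons.
case: IH => [->|[t nt [<- ->]]]; first by left; rewrite mul0r.
exact: normal_step.
Qed.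

(** A crude bound: only its independence of [t] matters, to make [F 1] nil. *)
Let normal_size t : t \in normal_words -> (size t < N.*2 + M.*2 + 5)%N.
Proof.
case/normal_wordsP => i [j [w [iN jM aw ->]]].
have w4 : (size w <= 4)%N by apply/(allP (_ : all (fun w => size w <= 4)%N alternating)).
rewrite !size_cat !size_nseq addnS ltnS.
by rewrite !leq_add // leq_double ltnW.
Qed.

(** A descending filtration by length: [F 0] will be the whole algebra and [F 1] its radical. *)
Let F d := <<[seq word t | t <- normal_words & (d <= size t)%N]>>%VS.

Let mem_F d t : t \in normal_words -> (d <= size t)%N -> word t \in F d.
Proof. by move=> nt dt; apply/memv_span/map_f; rewrite mem_filter dt. Qed.

Let F_mul d d' : (F d * F d' <= F (d + d')%N)%VS.
Proof.
apply: span_prod_sub => _ _ /mapP[s + ->] /mapP[t + ->].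
rewrite !mem_filter => /andP[ds ns] /andP[dt nt].
have -> : word s * word t = word (s ++ t) by rewrite /word big_cat.
have [->|[r nr [rs ->]]] := normal_form (s ++ t); first exact: mem0v.
by rewrite mem_F // rs size_cat leq_add.
Qed.

Let F_full : F 0 = fullv.
Proof.
apply: gen => [|u Fu]; first by have := mem_F 0 [::] nil_normal isT; rewrite /word big_nil.
have F1 e : letter e \in F 0.
  have [|[t nt [_]]] := normal_form [:: e]; rewrite /word big_seq1 => ->.
    exact: mem0v.
  exact: mem_F.
by split; apply: (subvP (F_mul 0 0)); rewrite memv_mul //;
  [exact: (F1 true) | exact: (F1 false)].
Qed.

(** [F 1] is a nil ideal: [u ^+ d] lies in [F d], which is zero once [d] exceeds every normal
    length. *)
Let F1_sub : (F 1 <= jacobson_radical A)%VS.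
Proof.
apply: nil_left_ideal_sub_jacobson_radical.
  by rewrite /left_ideal -F_full F_mul.
move=> u Fu; exists (N.*2 + M.*2 + 5)%N.
have Fud d : u ^+ d \in F d.
  elim: d => [|d IH]; first by rewrite F_full memvf.
  by rewrite exprSr -addn1; apply: (subvP (F_mul d 1)); rewrite memv_mul.
apply/eqP; rewrite -memv0; apply: subvP (Fud _).
apply/span_subvP => _ /mapP[t + ->]; rewrite mem_filter => /andP[+ /normal_size].
by rewrite leqNgt => /negbTE->.
Qed.

(** The empty word is the only one of length 0, so [A] is the sum of the scalars and [F 1]; a
    radical element with nonzero scalar part would put [1] in the radical. *)
Let jacobson_radicalE : jacobson_radical A = F 1.
Proof.
apply/eqP; rewrite eqEsubv F1_sub andbT; apply/subvP => u Ju.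
have : u \in (<[1]> + F 1)%VS.
  have: u \in F 0 by rewrite F_full memvf.
  apply: subvP; apply/span_subvP => _ /mapP[t + ->].
  rewrite mem_filter /= => nt; have [t0|t1] := posnP (size t).
    rewrite (size0nil t0) /word big_nil; apply: (subvP (addvSl _ _)).
    exact: memv_line.
  by apply: (subvP (addvSr _ _)); rewrite mem_F.
case/memv_addP => _ /vlineP[k ->] [v Fv uE].
have [k0|k0] := eqVneq k 0; first by rewrite uE k0 scale0r add0r.
case/negP: (@one_notin_jacobson_radical K A).
have -> : 1 = k^-1 *: (u - v) by rewrite uE addrK scalerA mulVf ?scale1r.
by rewrite memvZ // memvB // (subvP F1_sub).
Qed.

Lemma exists_filtered_multiplicative_basis :
  exists B : seq A, filtered_multiplicative_basis B.
Proof.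
pose B := [seq word t | t <- normal_words].
have Bb : basis_of fullv B.
  (* Freeness comes from counting: a spanning family with at most [\dim A] members is a basis. *)
  rewrite basisEdim; apply/andP; split; first by rewrite -F_full /F filter_predT.
  by rewrite size_map !size_allpairs !size_iota.
exists B; split=> //.
  move=> _ _ /mapP[s ns ->] /mapP[t nt ->].
  have -> : word s * word t = word (s ++ t) by rewrite /word big_cat.
  have [->|[r nr [_ ->]]] := normal_form (s ++ t); first by left.
  by right; apply: map_f.
(* A subfamily of a basis is free, so only the span is left to check. *)
rewrite /basis_of filter_free ?(basis_free Bb) // andbT eqEsubv.
apply/andP; split; first by apply/span_subvP => u; rewrite mem_filter => /andP[].
rewrite {1}jacobson_radicalE; apply/span_subvP => _ /mapP[t + ->].
rewrite mem_filter => /andP[t1 nt]; apply: memv_span.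
by rewrite mem_filter map_f // (subvP F1_sub) // mem_F.
Qed.

End MonomialBasis.

(** * A lower bound for the order of the presented group *)

Section GroupOrder.

Local Open Scope group_scope.

(** The pairs of booleans are the vertices of a square; [flip_fst] and [swap] are an axial and a
    diagonal reflection. *)
Let flip_fst (p : bool * bool) := (~~ p.1, p.2).
Let swap (p : bool * bool) := (p.2, p.1).

Let flip_fstK : involutive flip_fst.
Proof. by case=> [[] []]. Qed.

Let swapK : involutive swap.
Proof. by case. Qed.

Let A := perm (inv_inj flip_fstK).
Let B := perm (inv_inj swapK).
(** The commutator of the involutions [A] and [B], with inverses already simplified: the half
    turn. *)
Let C := A * (B * (A * B)).

Let permA2 : A * A = 1.
Proof. by apply/permP => p; rewrite !permM !permE flip_fstK. Qed.

Let permB2 : B * B = 1.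
Proof. by apply/permP => p; rewrite !permM !permE swapK. Qed.

Let permC2 : C * C = 1.
Proof. by apply/permP => [[[] []]]; rewrite !permM !permE. Qed.

Let permAV : A^-1 = A. Proof. by apply/eqP; rewrite eq_invg_mul permA2. Qed.
Let permBV : B^-1 = B. Proof. by apply/eqP; rewrite eq_invg_mul permB2. Qed.
Let permCV : C^-1 = C. Proof. by apply/eqP; rewrite eq_invg_mul permC2. Qed.

Let commAB : [~ A, B] = C.
Proof. by rewrite /commg /conjg permAV permBV. Qed.

Let commAC : [~ A, C] = 1.
Proof.
rewrite /commg /conjg permAV permCV.
by apply/permP => [[[] []]]; rewrite !permM !permE.
Qed.

Let commBC : [~ B, C] = 1.
Proof.
rewrite /commg /conjg permBV permCV.
by apply/permP => [[[] []]]; rewrite !permM !permE.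
Qed.

Let permC_neq1 : C <> 1.
Proof. by move/permP/(_ (true, true)); rewrite !permM !permE. Qed.

Let pairX (gT hT : finGroupType) (u : gT) (v : hT) k :
  (u, v) ^+ k = (u ^+ k, v ^+ k).
Proof. by elim: k => // k IH; rewrite !expgS IH. Qed.

Let pairR (gT hT : finGroupType) (u u' : gT) (v v' : hT) :
  [~ (u, v), (u', v')] = ([~ u, u'], [~ v, v']).
Proof. by []. Qed.

(* The lower bound on the order needs a model: the subgroup generated by
   (A, 1, 0) and (B, 0, 1) in D8 * Z/2^n * Z/2^m, where the reflections A and B
   generate D8 and [~ A, B] is its nontrivial central element. *)
Lemma card_presented_group (n m : nat) (hn : (0 < n)%N) (hm : (0 < m)%N)
    (gT : finGroupType) :
    [set: gT] \isog Grp (a : b :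
       (a ^+ (2 ^ n)%N = b ^+ (2 ^ m)%N = 1, [~ a, b] ^+ 2 = 1,
        [~ a, [~ a, b]] = 1, [~ b, [~ a, b]] = 1)) ->
  (2 ^ n * 2 ^ m * 2 <= #|gT|)%N.
Proof.
move=> isoG.
pose s : 'I_(2 ^ n).-1.+1 := Zp1; pose t : 'I_(2 ^ m).-1.+1 := Zp1.
have os : #[s] = (2 ^ n)%N by rewrite order_Zp1 prednK ?expn_gt0.
have ot : #[t] = (2 ^ m)%N by rewrite order_Zp1 prednK ?expn_gt0.
have sx : s ^+ (2 ^ n) = 1 by apply/eqP; rewrite -order_dvdn os.
have tx : t ^+ (2 ^ m) = 1 by apply/eqP; rewrite -order_dvdn ot.
pose a := (A, (s, 1 : 'I_(2 ^ m).-1.+1)); pose b := (B, (1 : 'I_(2 ^ n).-1.+1, t)).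
have cab : [~ a, b] = (C, (1, 1)).
  by rewrite !pairR commAB comm1g commg1.
have ax : a ^+ (2 ^ n) = 1.
  rewrite /a !pairX sx expg1n; congr (_, _).
  by rewrite -(prednK hn) expnS expgM [A ^+ 2]permA2 expg1n.
have bx : b ^+ (2 ^ m) = 1.
  rewrite /b !pairX tx expg1n; congr (_, _).
  by rewrite -(prednK hm) expnS expgM [B ^+ 2]permB2 expg1n.
have cx : [~ a, b] ^+ 2 = 1 by rewrite cab !pairX [C ^+ 2]permC2 !expg1n.
have acx : [~ a, [~ a, b]] = 1 by rewrite cab !pairR commAC !commg1.
have bcx : [~ b, [~ a, b]] = 1 by rewrite cab !pairR commBC !commg1.
(* Universal property of the presentation: the model is an image of [gT], hence no larger. *)
have /homgP[f Hf] : <[a]> <*> <[b]> \homg [set: gT].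
  rewrite isoG; apply/existsP; exists (a, b).
  by rewrite /= ax bx cx acx bcx eqxx.
rewrite -cardsT; apply: leq_trans (leq_morphim f [set: gT]); rewrite Hf.
(* The products [a ^+ i * b ^+ j * c ^+ k] are distinct: the cyclic components recover [i] and [j],
   then [C <> 1] recovers [k]. *)
pose g (i : 'I_(2 ^ n) * 'I_(2 ^ m) * bool) := a ^+ i.1.1 * b ^+ i.1.2 * [~ a, b] ^+ i.2.
have ginj : injective g.
  case=> [[i j] k] [[i' j'] k']; rewrite /g cab /a /b !pairX !expg1n => e.
  have eAB : A ^+ i * B ^+ j * C ^+ k = A ^+ i' * B ^+ j' * C ^+ k' := congr1 fst e.
  have es : s ^+ i * 1 * 1 = s ^+ i' * 1 * 1 := congr1 (fst \o snd) e.
  have et : 1 * t ^+ j * 1 = 1 * t ^+ j' * 1 := congr1 (snd \o snd) e.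
  have /val_inj ei : val i = val i'.
    move: es; rewrite !mulg1 => /eqP; rewrite eq_expg_mod_order os.
    by rewrite !modn_small // => /eqP.
  have /val_inj ej : val j = val j'.
    move: et; rewrite !mulg1 !mul1g => /eqP; rewrite eq_expg_mod_order ot.
    by rewrite !modn_small // => /eqP.
  move: eAB; clear e; rewrite ei ej => /mulgI.
  case: k k' => [] [] // e; case: permC_neq1.
  exact: esym e.
have -> : (2 ^ n * 2 ^ m * 2)%N = #|codom g|.
  by rewrite card_codom // !card_prod !card_ord card_bool.
apply/subset_leq_card/subsetP => _ /codomP[[[i j] k] ->] /=.
have Ha : a \in <[a]> <*> <[b]> by rewrite (subsetP (joing_subl _ _)) ?cycle_id.
have Hb : b \in <[a]> <*> <[b]> by rewrite (subsetP (joing_subr _ _)) ?cycle_id.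
by rewrite !groupM ?groupX ?groupR.
Qed.
End GroupOrder.

(** * Identities in characteristic 2 *)

Section Relations.

Import GRing.Theory.
Local Open Scope ring_scope.

(** With [p = xy] and [q = ab] one has [yx = p + zq]. After multiplication by [z], [p] and [q]
    commute, so the square of [p + zq] is [p * p] plus twice [z * (p * q)] plus a multiple of
    [z * z], that is [p * p]. *)
Lemma alternating_product_pchar2 (R : nzRingType) (charR : 2%N \in [pchar R])
    (a b z : R) :
    z * a = a * z -> z * b = b * z -> z * z = 0 -> a * b + b * a = z * (a * b) ->
  (a + 1) * (b + 1) * (a + 1) * (b + 1) = (b + 1) * (a + 1) * (b + 1) * (a + 1).
Proof.
move=> za zb zz; set x := a + 1; set y := b + 1 => abE.
have zx : z * x = x * z by rewrite mulrDl mulrDr za mulr1 mul1r.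
have zy : z * y = y * z by rewrite mulrDl mulrDr zb mulr1 mul1r.
have yxE : y * x = x * y + z * (a * b).
  have -> : x * y = a * b + (a + b + 1).
    by rewrite mulrDr mulr1 mulrDl mul1r !addrA [a * b + b + a]addrAC.
  have -> : y * x = b * a + (a + b + 1).
    by rewrite mulrDr mulr1 mulrDl mul1r !addrA.
  by rewrite -abE addrACA addrr_pchar2 // add0r addrC.
have zyx : z * (y * x) = z * (x * y) by rewrite yxE mulrDr (mulrA z z) zz mul0r addr0.
(* Commutation up to the annihilator of [z]; it passes from [a], [b] to [x], [y] and their
   products. *)
pose zcomm u v := z * (u * v) = z * (v * u).
have zcommM u v w : z * u = u * z -> zcomm u w -> zcomm v w -> zcomm (u * v) w.
  rewrite /zcomm => zu uw vw.
  by rewrite -mulrA mulrA zu -mulrA vw !mulrA -zu -(mulrA z) uw !mulrA.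
have zcomm_refl u : zcomm u u by [].
have zcomm_sym u v : zcomm u v -> zcomm v u by [].
have zcommD1 u v : zcomm u v -> zcomm u (v + 1).
  by rewrite /zcomm => uv; rewrite mulrDr mulrDl !mulrDr uv mulr1 mul1r.
have zba : zcomm b a.
  by rewrite /zcomm; apply/eqP; rewrite -subr_eq0 -mulrBr oppr_pchar2 // addrC
    abE (mulrA z z) zz mul0r.
have zabxy : zcomm (x * y) (a * b).
  have zxa : zcomm x a by apply/zcomm_sym/zcommD1.
  have zyb : zcomm y b by apply/zcomm_sym/zcommD1.
  have zxb : zcomm x b by apply/zcomm_sym/zcommD1.
  have zya : zcomm y a by apply/zcomm_sym/zcommD1/zcomm_sym.
  apply: (zcommM) => //; apply: (zcomm_sym).
    by apply: (zcommM) => //; apply: (zcomm_sym).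
  by apply: (zcommM) => //; apply: (zcomm_sym).
have zab : z * (a * b) = a * b * z by rewrite mulrA za -mulrA zb mulrA.
have zxy : z * (x * y) = x * y * z by rewrite mulrA zx -mulrA zy mulrA.
rewrite -[x * y * x * y]mulrA -[y * x * y * x]mulrA yxE.
move: (x * y) (a * b) zabxy zab zxy => p q zpq zq zp.
have pzq : p * (z * q) = z * (p * q) by rewrite mulrA -zp mulrA.
have zqp : z * q * p = z * (p * q) by rewrite -mulrA -zpq.
have zqzq : z * q * (z * q) = 0 by rewrite {1}zq -mulrA (mulrA z z) zz mul0r mulr0.
by rewrite mulrDl !mulrDr pzq zqp zqzq addr0 -addrA addrr_pchar2 // addr0.
Qed.

(** Iterated squaring; since [a] commutes with 1, [R] may be noncommutative. *)
Lemma exprD1_pchar2 (R : nzRingType) (charR : 2%N \in [pchar R]) (a : R) k :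
  (a + 1) ^+ (2 ^ k) = a ^+ (2 ^ k) + 1.
Proof.
elim: k => [|k IH]; first by rewrite !expr1.
by rewrite expnSr !exprM IH sqrrD1 mulrn_pchar // addr0.
Qed.

Lemma expr2D1_pchar2 (R : nzRingType) (charR : 2%N \in [pchar R]) (a : R) :
  (a + 1) * (a + 1) = a * a + 1.
Proof. exact: (@exprD1_pchar2 R charR a 1). Qed.

End Relations.

(** * Application to the group algebra *)

Section GroupAlgebra.

Import GRing.Theory.
Local Open Scope ring_scope.

Context {K : fieldType} {gT : finGroupType}.
Local Notation elt := (galg_elt K).

Lemma galg_eltX (g : gT) k : elt (g ^+ k)%g = elt g ^+ k.
Proof. by elim: k => // k IH; rewrite expgS exprS galg_eltM IH. Qed.

Lemma dim_group_algebra : \dim {: group_algebra K gT} = #|gT|.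
Proof. by rewrite dimvf /dim /= muln1. Qed.

(** The [g] with [V * g] inside [V] form a subgroup containing both generators, hence all of [gT];
    applied to [1] in [V], this puts every group element in [V]. *)
Lemma group_algebra_generated (a b : gT) (V : {vspace group_algebra K gT}) :
    (<[a]> <*> <[b]> = [set: gT])%g -> 1 \in V ->
    {in V, forall u, u * elt a \in V /\ u * elt b \in V} ->
  V = fullv.
Proof.
move=> genG V1 Vab; pose S := [set g : gT | (V * <[elt g]> <= V)%VS].
have group_S : group_set S.
  apply/group_setP; split=> [|g h]; first by rewrite inE galg_elt1 prodv1.
  rewrite !inE => gS hS; rewrite galg_eltM -prodv_line prodvA.
  exact: subv_trans (prodvSl _ gS) hS.
have SG : [set: gT] \subset group group_S.
  have sub_S g : {in V, forall u, u * elt g \in V} -> (<[g]> \subset group group_S)%g.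
    move=> Vg; rewrite cycle_subG inE; apply/prodvP => u _ Vu /vlineP[k ->].
    by rewrite -scalerAr memvZ ?Vg.
  by rewrite -genG join_subG !sub_S // => u /Vab[].
apply/eqP; rewrite eqEsubv subvf; apply/subvP => u _.
rewrite (galg_sum_elt u); apply: memv_suml => g _; apply: memvZ.
have /(subsetP SG) := in_setT g; rewrite inE => /prodvP/(_ 1 (elt g) V1).
by rewrite mul1r; apply; apply: memv_line.
Qed.

Lemma group_algebra_filtered_basis (charK : 2%N \in [pchar K]) n m (a b : gT) :
    (0 < n)%N -> (0 < m)%N -> (<[a]> <*> <[b]> = [set: gT])%g ->
    (a ^+ (2 ^ n) = 1)%g -> (b ^+ (2 ^ m) = 1)%g -> ([~ a, b] ^+ 2 = 1)%g ->
    [~ a, [~ a, b]]%g = 1%g -> [~ b, [~ a, b]]%g = 1%g ->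
    (2 ^ n * 2 ^ m * 2 <= #|gT|)%N ->
  exists B : seq (group_algebra K gT), filtered_multiplicative_basis B.
Proof.
move=> n_gt0 m_gt0 genG ax bx cx acx bcx leG.
have cc : ([~ a, b] * [~ a, b] = 1)%g := cx.
have ca : ([~ a, b] * a = a * [~ a, b])%g by apply/esym/commgP/eqP.
have cb : ([~ a, b] * b = b * [~ a, b])%g by apply/esym/commgP/eqP.
have ab : (a * b = b * a * [~ a, b])%g by exact: commgC.
have ba : (b * a = a * b * [~ a, b])%g by rewrite ab -mulgA cc mulg1.
move: {cx acx bcx} [~ a, b]%g cc ca cb ab ba => c cc ca cb ab ba.
(* Each passage of [b] across an [a] costs one central factor [c], and the two cancel. *)
have a2b : (a * a * b = b * (a * a))%g.
  by rewrite -mulgA ab mulgA mulgA ab -!mulgA (mulgA c) ca -(mulgA a) cc mulg1.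
have b2a : (b * b * a = a * (b * b))%g.
  by rewrite -mulgA ba mulgA mulgA ba -!mulgA (mulgA c) cb -(mulgA b) cc mulg1.
have charA : 2%N \in [pchar group_algebra K gT] by rewrite pchar_lalg.
have commD1 u v : GRing.comm u v -> GRing.comm (u + 1 : group_algebra K gT) (v + 1).
  move=> uv; apply: commrD (commr1 _).
  by apply/commr_sym/commrD; [exact: commr_sym | exact: commr1].
have nil2 (g : gT) k : (0 < k)%N -> (g ^+ (2 ^ k) = 1)%g ->
    (((elt g + 1) * (elt g + 1)) ^+ (2 ^ k.-1) = 0).
  move=> k0 gk; rewrite -expr2 -exprM -expnS prednK // exprD1_pchar2 //.
  by rewrite -galg_eltX gk galg_elt1 addrr_pchar2.
apply: (exists_filtered_multiplicative_basis (elt a + 1)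
  (elt b + 1) (2 ^ n.-1) (2 ^ m.-1)).
- by rewrite expr2D1_pchar2 //; apply: commD1; rewrite /GRing.comm -!galg_eltM a2b.
- by rewrite expr2D1_pchar2 //; apply: commD1; rewrite /GRing.comm -!galg_eltM b2a.
(* The choice [z = 1 + c] works: [z * z = 1 + c * c = 0], and [ba = abc] gives
   [ab + ba = (1 + c)ab]. *)
- apply: (alternating_product_pchar2 _ charA _ _ (1 + elt c)).
  + by rewrite mulrDl mulrDr mulr1 mul1r -!galg_eltM ca.
  + by rewrite mulrDl mulrDr mulr1 mul1r -!galg_eltM cb.
  + by rewrite addrC expr2D1_pchar2 // -galg_eltM cc addrr_pchar2.
  + by rewrite mulrDl mul1r -!galg_eltM mulgA ca -mulgA cb mulgA -ba.
- exact: nil2.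
- exact: nil2.
- move=> V V1 Vxy; apply: (group_algebra_generated a b V genG V1) => u Vu.
  have [Vx Vy] := Vxy u Vu.
  by split; [move: (memvB Vx Vu) | move: (memvB Vy Vu)];
    rewrite mulrDr mulr1 addrK.
(* The 8 alternating words make up for the halved exponents:
   [2^(n-1) * 2^(m-1) * 8 = 2^n * 2^m * 2]. *)
- rewrite dim_group_algebra; apply: leq_trans leG.
  by rewrite -[n in leqRHS](prednK n_gt0) -[m in leqRHS](prednK m_gt0) !expnS; lia.
Qed.

End GroupAlgebra.

Theorem theorem2 (K : fieldType) (charK : 2%N \in [pchar K]%R)
    (n m : nat) (hn : (2 <= n)%N) (hm : (2 <= m)%N)
    (gT : finGroupType)
    (presG : ([set: gT] \isog Grp (a : b :
       (a ^+ (2 ^ n)%N = b ^+ (2 ^ m)%N = 1, [~ a, b] ^+ 2 = 1,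
        [~ a, [~ a, b]] = 1, [~ b, [~ a, b]] = 1)))%g) :
  exists B : seq (group_algebra K gT), filtered_multiplicative_basis B.
Proof.
have n_gt0 : (0 < n)%N by apply: leq_trans hn.
have m_gt0 : (0 < m)%N by apply: leq_trans hm.
have /existsP[[a b] /= /eqP[genG ax bx cx acx bcx]] := isoGrp_hom presG.
apply: (@group_algebra_filtered_basis K gT charK n m a b) => //.
exact: card_presented_group presG.
Qed.
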